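(* Let $(H,\mathcal{R},\chi)$ be a pre-Cartier bialgebra, $V$ a left $H$-module and $n\geq 2$. Then there is a representation of the $n$-th Cartier ring, i.e. a (unital) ring homomorphism $$\rho_n^{\mathcal{R},\chi}\colon\mathsf{C}_n\to\mathrm{End}(V^{\otimes n}),\qquad \beta_i\mapsto\mathcal{R}_i,\quad \gamma_i\mapsto\chi_i\qquad(1\leq i\leq n-1),$$ where $$\mathcal{R}_i(v_1\otimes\cdots\otimes v_n)=v_1\otimes\cdots\otimes v_{i-1}\otimes\mathcal{R}^{\mathrm{op}}\cdot(v_{i+1}\otimes v_i)\otimes v_{i+2}\otimes\cdots\otimes v_n,$$ $$\chi_i(v_1\otimes\cdots\otimes v_n)=v_1\otimes\cdots\otimes v_{i-1}\otimes\chi\cdot(v_i\otimes v_{i+1})\otimes v_{i+2}\otimes\cdots\otimes v_n.$$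
   Context: $\Bbbk$ is a field of characteristic zero; algebras are associative unital over $\Bbbk$, $\otimes=\otimes_\Bbbk$. For $A=\sum A^1\otimes A^2\in H\otimes H$ put $A^{\mathrm{op}}=\sum A^2\otimes A^1$, $A_{12}=A\otimes 1$, $A_{23}=1\otimes A$, $A_{13}=\sum A^1\otimes 1\otimes A^2$. A pre-Cartier bialgebra is a bialgebra $(H,\Delta,\varepsilon)$ with a quasitriangular structure, i.e. an invertible $\mathcal{R}\in H\otimes H$ with $\Delta^{\mathrm{op}}(\cdot)=\mathcal{R}\Delta(\cdot)\mathcal{R}^{-1}$, $(\mathrm{id}\otimes\Delta)(\mathcal{R})=\mathcal{R}_{13}\mathcal{R}_{12}$, $(\Delta\otimes\mathrm{id})(\mathcal{R})=\mathcal{R}_{13}\mathcal{R}_{23}$, together with an element $\chi\in H\otimes H$ such that $\chi\Delta(\cdot)=\Delta(\cdot)\chi$, $(\mathrm{id}\otimes\Delta)(\chi)=\chi_{12}+\mathcal{R}_{12}^{-1}\chi_{13}\mathcal{R}_{12}$, $(\Delta\otimes\mathrm{id})(\chi)=\chi_{23}+\mathcal{R}_{23}^{-1}\chi_{13}\mathcal{R}_{23}$. For $n\geq 2$ the $n$-th Cartier ring $\mathsf{C}_n$ is the (unital associative) ring generated by $n-1$ invertible elements $\beta_1,\dots,\beta_{n-1}$ and $n-1$ non-invertible elements $\gamma_1,\dots,\gamma_{n-1}$ (i.e. inverses are adjoined only for the $\beta_i$) subject to the relations $\beta_i\beta_j=\beta_j\beta_i$, $\gamma_i\gamma_j=\gamma_j\gamma_i$,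 $\beta_i\gamma_j=\gamma_j\beta_i$ for all $i,j$ with $|i-j|\geq 2$, and, for all $i=1,\dots,n-2$, $$\beta_i\beta_{i+1}\beta_i=\beta_{i+1}\beta_i\beta_{i+1},$$ $$\beta_i(\gamma_i\beta_{i+1}+\beta_{i+1}\gamma_{i+1})\beta_i+\beta_i\beta_{i+1}\beta_i\gamma_i=\beta_{i+1}(\gamma_{i+1}\beta_i+\beta_i\gamma_i)\beta_{i+1}+\beta_{i+1}\beta_i\beta_{i+1}\gamma_{i+1}.$$ *)

(* Defs.v *)
From HB Require Import structures.
From mathcomp Require Import all_boot all_algebra.
From mathcomp Require Import boolp.

Set Implicit Arguments.
Unset Strict Implicit.
Unset Printing Implicit Defensive.

Import GRing.Theory.
Local Open Scope ring_scope.
Local Open Scope quotient_scope.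

Definition tset (T : Type) (n : nat) (v : n.-tuple T) (i : 'I_n) (x : T) :
    n.-tuple T :=
  [tuple if j == i then x else tnth v j | j < n].

Definition multilinear (k : fieldType) (V W : lmodType k) (n : nat)
    (f : n.-tuple V -> W) : Prop :=
  forall (v : n.-tuple V) (i : 'I_n), linear (fun x => f (tset v i x)).

Section TensorPower.
Variables (k : fieldType) (n : nat) (V : lmodType k).

(* A list [:: (a1, v1); ...; (ar, vr)] stands for the formal linear
   combination a1 v1 + ... + ar vr of tuples; [tens_eq] is the congruence
   generated by the laws of the free vector space on n.-tuple V together with
   multilinearity. *)
Inductive tens_eq : seq (k * n.-tuple V) -> seq (k * n.-tuple V) -> Prop :=
| tens_refl s : tens_eq s s
| tens_sym s t : tens_eq s t -> tens_eq t s
| tens_trans s t u : tens_eq s t -> tens_eq t u -> tens_eq s u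
| tens_cat s s' t t' :
    tens_eq s s' -> tens_eq t t' -> tens_eq (s ++ t) (s' ++ t')
| tens_comm s t : tens_eq (s ++ t) (t ++ s)
| tens_coefD a b v : tens_eq [:: (a, v); (b, v)] [:: (a + b, v)]
| tens_coef0 v : tens_eq [:: (0, v)] [::]
| tens_vecD a v i x y :
    tens_eq [:: (a, tset v i (x + y))] [:: (a, tset v i x); (a, tset v i y)]
| tens_vecZ a v i c x :
    tens_eq [:: (a, tset v i (c *: x))] [:: (a * c, tset v i x)].

Definition tens_eqb (s t : seq (k * n.-tuple V)) : bool := `[< tens_eq s t >].

Lemma tens_eqb_refl : reflexive tens_eqb.
Proof. by move=> s; apply/asboolP; exact: tens_refl. Qed.

Lemma tens_eqb_sym : symmetric tens_eqb.
Proof. by move=> s t; apply/asboolP/asboolP; exact: tens_sym. Qed.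

Lemma tens_eqb_trans : transitive tens_eqb.
Proof.
by move=> t s u /asboolP st /asboolP tu; apply/asboolP; exact: tens_trans tu.
Qed.

Canonical tens_equiv :=
  EquivRel tens_eqb tens_eqb_refl tens_eqb_sym tens_eqb_trans.

Definition tpow := {eq_quot tens_equiv}.

HB.instance Definition _ := Choice.on tpow.
HB.instance Definition _ := Quotient.on tpow.
HB.instance Definition _ := EqQuotient.on tpow.

Definition tclass (s : seq (k * n.-tuple V)) : tpow := \pi_tpow s.

Lemma tclassK x : tclass (repr x) = x.
Proof. exact: reprK. Qed.

Lemma tpow_eqP s t : tens_eq s t <-> tclass s = tclass t.
Proof.
split=> [h|/eqquotP/asboolP //]; by apply/eqquotP/asboolP.
Qed.

Lemma tens_repr s : tens_eq (repr (tclass s)) s.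
Proof. by apply/tpow_eqP; rewrite tclassK. Qed.

Let sc (c : k) (s : seq (k * n.-tuple V)) := [seq (c * p.1, p.2) | p <- s].

Lemma tens_scale c s t : tens_eq s t -> tens_eq (sc c s) (sc c t).
Proof.
elim=> {s t} [s|s t _|s t u _ IH1 _|s s' t t' _ IH1 _ IH2|s t|a b v|v|a v i x y|a v i d x] /=.
- exact: tens_refl.
- exact: tens_sym.
- exact: tens_trans.
- by rewrite /sc !map_cat; apply: tens_cat.
- by rewrite /sc !map_cat; apply: tens_comm.
- by rewrite mulrDr; apply: tens_coefD.
- by rewrite mulr0; apply: tens_coef0.
- exact: tens_vecD.
- by rewrite mulrA; apply: tens_vecZ.
Qed.

Definition tpow_add (x y : tpow) : tpow := tclass (repr x ++ repr y).
Definition tpow_scale (c : k) (x : tpow) : tpow :=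
  tclass [seq (c * p.1, p.2) | p <- repr x].
Definition tpow_opp (x : tpow) : tpow := tpow_scale (- 1) x.

Lemma tpow_addE s t : tpow_add (tclass s) (tclass t) = tclass (s ++ t).
Proof. by apply/tpow_eqP; apply: tens_cat; exact: tens_repr. Qed.

Lemma tpow_scaleE c s : tpow_scale c (tclass s) = tclass (sc c s).
Proof. by apply/tpow_eqP; apply: tens_scale; exact: tens_repr. Qed.

Lemma tens_sc0 s : tens_eq (sc 0 s) [::].
Proof.
elim: s => [|p s IH] /=; first exact: tens_refl.
rewrite mul0r; apply: (@tens_cat [:: _] [::] _ [::]) => //; exact: tens_coef0.
Qed.

Lemma tens_scD a b s : tens_eq (sc (a + b) s) (sc a s ++ sc b s).
Proof.
elim: s => [|p s IH] /=; first exact: tens_refl.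
rewrite mulrDl; set x := (a * p.1, p.2); set y := (b * p.1, p.2).
have E1 : tens_eq ([:: (a * p.1 + b * p.1, p.2)] ++ sc (a + b) s)
    ([:: x; y] ++ (sc a s ++ sc b s)).
  by apply: tens_cat IH; exact: tens_sym (tens_coefD _ _ _).
have E2 : tens_eq (([:: y] ++ sc a s) ++ sc b s)
    ((sc a s ++ [:: y]) ++ sc b s).
  by apply: tens_cat (tens_refl _); exact: tens_comm.
have := tens_trans E1 (tens_cat (tens_refl [:: x]) E2).
by rewrite -catA.
Qed.

Fact tpow_addA : associative tpow_add.
Proof.
move=> x y z; rewrite -[x]tclassK -[y]tclassK -[z]tclassK.
by rewrite (tpow_addE (repr y)) (tpow_addE (repr x)) !tpow_addE catA.
Qed.

Fact tpow_addC : commutative tpow_add.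
Proof. by move=> x y; rewrite /tpow_add; apply/tpow_eqP; exact: tens_comm. Qed.

Fact tpow_add0 : left_id (tclass [::]) tpow_add.
Proof. by move=> x; rewrite -[x]tclassK tpow_addE. Qed.

Fact tpow_scale1 : left_id 1 tpow_scale.
Proof.
move=> x; rewrite -[x]tclassK tpow_scaleE; congr tclass.
by rewrite /sc -[RHS]map_id; apply: eq_map => -[a v] /=; rewrite mul1r.
Qed.

Fact tpow_scaleDl x : {morph tpow_scale^~ x : a b / a + b >-> tpow_add a b}.
Proof.
move=> a b; rewrite -[x]tclassK !tpow_scaleE tpow_addE.
by apply/tpow_eqP; exact: tens_scD.
Qed.

Fact tpow_addN : left_inverse (tclass [::]) tpow_opp tpow_add.
Proof.
move=> x; rewrite -{2}[x]tpow_scale1 /tpow_opp -tpow_scaleDl addNr.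
by apply/tpow_eqP; exact: tens_sc0.
Qed.

HB.instance Definition _ :=
  GRing.isZmodule.Build tpow tpow_addA tpow_addC tpow_add0 tpow_addN.

Fact tpow_scaleA a b x : tpow_scale a (tpow_scale b x) = tpow_scale (a * b) x.
Proof.
rewrite -[x]tclassK !tpow_scaleE; congr tclass.
by rewrite /sc -map_comp; apply: eq_map => p /=; rewrite mulrA.
Qed.

Fact tpow_scaleDr : right_distributive tpow_scale +%R.
Proof.
move=> a x y; rewrite -[x]tclassK -[y]tclassK.
by rewrite [_ + _]tpow_addE !tpow_scaleE [RHS]tpow_addE /sc map_cat.
Qed.

HB.instance Definition _ := GRing.Zmodule_isLmodule.Build k tpow
  tpow_scaleA tpow_scale1 tpow_scaleDr tpow_scaleDl.

Definition tpure (v : n.-tuple V) : tpow := tclass [:: (1, v)].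

Lemma tclassE s : tclass s = \sum_(p <- s) p.1 *: tpure p.2.
Proof.
elim: s => [|p s IH]; first by rewrite big_nil.
rewrite big_cons -IH [_ *: _]tpow_scaleE [_ + _]tpow_addE /sc /= mulr1.
by case: p.
Qed.

Lemma tpow_ind (P : tpow -> Prop) :
  P 0 -> (forall a v x, P x -> P (a *: tpure v + x)) -> forall x, P x.
Proof.
move=> P0 PD x; rewrite -[x]tclassK tclassE; elim: (repr x) => [|p s IH].
  by rewrite big_nil.
by rewrite big_cons; exact: PD.
Qed.

Lemma tpure_multilinear : multilinear tpure.
Proof.
move=> v i a x y; rewrite /tpure.
have -> : a *: tclass [:: (1, tset v i x)] = tclass [:: (1 * a, tset v i x)].
  by rewrite [LHS]tpow_scaleE /sc /= mulr1 mul1r.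
rewrite -(proj1 (tpow_eqP _ _) (tens_vecZ 1 v i a x)).
rewrite [RHS]tpow_addE; apply/tpow_eqP; exact: tens_vecD.
Qed.

Lemma tpure_linear (g : V -> n.-tuple V) v i :
  (forall x, g x = tset v i x) -> linear (fun x => tpure (g x)).
Proof. by move=> E a x y; rewrite !E tpure_multilinear. Qed.

Definition tlift (W : lmodType k) (f : n.-tuple V -> W)
    (hf : multilinear f) (x : tpow) : W :=
  \sum_(p <- repr x) p.1 *: f p.2.

Section Lift.
Variables (W : lmodType k) (f : n.-tuple V -> W) (hf : multilinear f).

Lemma tens_eq_sum s t : tens_eq s t ->
  \sum_(p <- s) p.1 *: f p.2 = \sum_(p <- t) p.1 *: f p.2.
Proof.
have fD v i x y : f (tset v i (x + y)) = f (tset v i x) + f (tset v i y).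
  by have := hf v i 1 x y; rewrite !scale1r.
have f0 v i : f (tset v i 0) = 0.
  by apply: (addrI (f (tset v i 0))); rewrite -fD !addr0.
have fZ v i a x : f (tset v i (a *: x)) = a *: f (tset v i x).
  by have := hf v i a x 0; rewrite f0 !addr0.
elim=> {s t} [s|s t _|s t u _ IH1 _|s s' t t' _ IH1 _ IH2|s t|a b v|v|a v i x y|a v i c x] //=.
- by rewrite IH1.
- by rewrite !big_cat /= IH1 IH2.
- by rewrite !big_cat /= addrC.
- by rewrite !big_cons !big_nil /= !addr0 scalerDl.
- by rewrite big_cons !big_nil /= scale0r addr0.
- by rewrite !big_cons !big_nil /= !addr0 fD scalerDr.
- by rewrite !big_cons !big_nil /= !addr0 fZ scalerA.
Qed.

Lemma tlift_class s : tlift hf (tclass s) = \sum_(p <- s) p.1 *: f p.2.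
Proof. exact/tens_eq_sum/tens_repr. Qed.

Lemma tlift_linear : linear (tlift hf).
Proof.
move=> a x y; rewrite -[x]tclassK -[y]tclassK.
rewrite [_ *: _]tpow_scaleE [_ + _]tpow_addE !tlift_class big_cat big_map /=.
rewrite scaler_sumr; congr (_ + _); apply: eq_bigr => p _.
by rewrite scalerA.
Qed.

HB.instance Definition _ :=
  GRing.isLinear.Build k tpow W _ (tlift hf) tlift_linear.

Lemma tlift_pure v : tlift hf (tpure v) = f v.
Proof. by rewrite tlift_class big_seq1 scale1r. Qed.

End Lift.

Lemma tpow_linear_eq (W : lmodType k) (f g : tpow -> W) :
  linear f -> linear g -> (forall v, f (tpure v) = g (tpure v)) -> f =1 g.
Proof.
move=> lf lg fg.
have l0 h : linear h -> h 0 = 0 :> W.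
  move=> lh; have := lh 1 0 0; rewrite !scale1r addr0 => E.
  by apply: (addrI (h 0)); rewrite -E addr0.
elim/tpow_ind => [|a v x IH]; first by rewrite !l0.
by rewrite lf lg fg IH.
Qed.

End TensorPower.

Arguments tpow {k} n V.
Arguments tpure {k n V} v.

Section Bilinear.
Variables (k : fieldType) (m n : nat) (U V W : lmodType k).

Definition multilinear2 (f : m.-tuple U -> n.-tuple V -> W) : Prop :=
  (forall v, multilinear (f^~ v)) /\ (forall u, multilinear (f u)).

Variables (f : m.-tuple U -> n.-tuple V -> W) (hf : multilinear2 f).

Lemma tlift2_multilinear (y : tpow n V) :
  multilinear (fun u => tlift (hf.2 u) y).
Proof.
move=> u i a x x'; elim/tpow_ind: y => [|b v y IH] /=.
  by rewrite !linear0 addr0.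
rewrite !linearP /= !tlift_pure IH (hf.1 v) !scalerDr !scalerA mulrC.
by rewrite addrACA.
Qed.

Definition tlift2 (x : tpow m U) (y : tpow n V) : W :=
  tlift (tlift2_multilinear y) x.

Lemma tlift2_pure u v : tlift2 (tpure u) (tpure v) = f u v.
Proof. by rewrite /tlift2 !tlift_pure. Qed.

Lemma tlift2_linearl y : linear (tlift2^~ y).
Proof. by move=> a x x'; rewrite /tlift2 linearP. Qed.

Lemma tlift2_linearr x : linear (tlift2 x).
Proof.
move=> a y y'; elim/tpow_ind: x => [|b u x IH].
  by rewrite /tlift2 !linear0 addr0.
rewrite !tlift2_linearl IH /tlift2 !tlift_pure linearP.
by rewrite !scalerDr !scalerA mulrC addrACA.
Qed.

End Bilinear.

Lemma tnth_tset (T : Type) n (v : n.-tuple T) i x j :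
  tnth (tset v i x) j = if j == i then x else tnth v j.
Proof. by rewrite tnth_mktuple. Qed.

Section Componentwise.
Variables (k : fieldType) (n : nat) (U V W : lmodType k).
Variables (b : U -> V -> W).
Hypothesis hb : bilinear_for *:%R *:%R b.

Fact tmap2_multilinear :
  multilinear2 (fun (u : n.-tuple U) (v : n.-tuple V) =>
    tpure [tuple b (tnth u i) (tnth v i) | i < n]).
Proof.
split=> [v u|u v] i a x y.
- have E z : [tuple b (tnth (tset u i z) j) (tnth v j) | j < n] =
    tset [tuple b (tnth u j) (tnth v j) | j < n] i (b z (tnth v i)).
    apply: eq_from_tnth => j; rewrite tnth_tset !tnth_mktuple.
    by case: eqP => [->|].
  by rewrite !E hb.1 tpure_multilinear.
- have E z : [tuple b (tnth u j) (tnth (tset v i z) j) | j < n] =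
    tset [tuple b (tnth u j) (tnth v j) | j < n] i (b (tnth u i) z).
    apply: eq_from_tnth => j; rewrite tnth_tset !tnth_mktuple.
    by case: eqP => [->|].
  by rewrite !E hb.2 tpure_multilinear.
Qed.

Definition tmap2 : tpow n U -> tpow n V -> tpow n W := tlift2 tmap2_multilinear.

Lemma tmap2_linearl y : linear (tmap2^~ y).
Proof. exact: tlift2_linearl. Qed.

Lemma tmap2_linearr x : linear (tmap2 x).
Proof. exact: tlift2_linearr. Qed.

Lemma tmap2_pure u v :
  tmap2 (tpure u) (tpure v) = tpure [tuple b (tnth u i) (tnth v i) | i < n].
Proof. exact: tlift2_pure. Qed.

End Componentwise.

Section Concatenation.
Variables (k : fieldType) (m n : nat) (V : lmodType k).

Fact tcat_multilinear :
  multilinear2 (fun (u : m.-tuple V) (v : n.-tuple V) =>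
    tpure (cat_tuple u v)).
Proof.
split=> [v u|u v] i a x y.
- have E z : cat_tuple (tset u i z) v = tset (cat_tuple u v) (lshift n i) z.
    apply: eq_from_tnth => j; rewrite tnth_tset.
    case: (splitP j) => j' Ej.
      have -> : j = lshift n j' by exact: val_inj.
      by rewrite !tnth_lshift tnth_tset (inj_eq (@lshift_inj _ _)).
    have -> : j = rshift m j' by exact: val_inj.
    by rewrite !tnth_rshift eq_rlshift.
  by rewrite !E tpure_multilinear.
- have E z : cat_tuple u (tset v i z) = tset (cat_tuple u v) (rshift m i) z.
    apply: eq_from_tnth => j; rewrite tnth_tset.
    case: (splitP j) => j' Ej.
      have -> : j = lshift n j' by exact: val_inj.
      by rewrite !tnth_lshift eq_lrshift.
    have -> : j = rshift m j' by exact: val_inj.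
    by rewrite !tnth_rshift tnth_tset (inj_eq (@rshift_inj _ _)).
  by rewrite !E tpure_multilinear.
Qed.

Definition tcat : tpow m V -> tpow n V -> tpow (m + n) V :=
  tlift2 tcat_multilinear.

Lemma tcat_linearl y : linear (tcat^~ y).
Proof. exact: tlift2_linearl. Qed.

Lemma tcat_linearr x : linear (tcat x).
Proof. exact: tlift2_linearr. Qed.

Lemma tcat_pure u v : tcat (tpure u) (tpure v) = tpure (cat_tuple u v).
Proof. exact: tlift2_pure. Qed.

End Concatenation.

Section Degree2.
Variables (k : fieldType) (V W : lmodType k) (b : V -> V -> W).
Hypothesis hb : bilinear_for *:%R *:%R b.

Fact blift_multilinear :
  multilinear (fun v : 2.-tuple V => b (tnth v ord0) (tnth v ord_max)).
Proof.
move=> v i a x y; rewrite !tnth_tset.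
case: (unliftP ord0 i) => [j ->|->] /=; last by rewrite hb.1.
by rewrite ord1 /= hb.2.
Qed.

Definition blift : tpow 2 V -> W := tlift blift_multilinear.

Lemma blift_pure x y : blift (tpure [tuple x; y]) = b x y.
Proof. exact: tlift_pure. Qed.

End Degree2.

Section AlgebraPower.
Variables (k : fieldType) (n : nat) (H : algType k).

Fact mul_bilinear : bilinear_for *:%R *:%R (fun x y : H => x * y).
Proof.
split=> z a x y /=; first by rewrite mulrDl scalerAl.
by rewrite mulrDr scalerAr.
Qed.

Definition tpow_one : tpow n H := tpure [tuple 1 | i < n].
Definition tpow_mul : tpow n H -> tpow n H -> tpow n H := tmap2 mul_bilinear.

Let tpow_mul_pure u v : tpow_mul (tpure u) (tpure v) =
  tpure [tuple tnth u i * tnth v i | i < n].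
Proof. exact: tmap2_pure. Qed.

Let mull y : linear (tpow_mul^~ y). Proof. exact: tlift2_linearl. Qed.
Let mulr x : linear (tpow_mul x). Proof. exact: tlift2_linearr. Qed.

Fact tpow_mul1 : left_id tpow_one tpow_mul.
Proof.
apply: tpow_linear_eq => [a y z|a y z|v] //; rewrite ?mull ?mulr //.
rewrite tpow_mul_pure; congr tpure; apply: eq_from_tnth => i.
by rewrite !tnth_mktuple mul1r.
Qed.

Fact tpow_mulr1 : right_id tpow_one tpow_mul.
Proof.
apply: tpow_linear_eq => [a y z|a y z|v] //; rewrite ?mull ?mulr //.
rewrite tpow_mul_pure; congr tpure; apply: eq_from_tnth => i.
by rewrite !tnth_mktuple mulr1.
Qed.

Fact tpow_mulDl : left_distributive tpow_mul +%R.
Proof. by move=> x y z; have := mull z 1 x y; rewrite !scale1r. Qed.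

Fact tpow_mulDr : right_distributive tpow_mul +%R.
Proof. by move=> x y z; have := mulr x 1 y z; rewrite !scale1r. Qed.

Fact tpow_mulA : associative tpow_mul.
Proof.
move=> x y; apply: tpow_linear_eq => [a z z'|a z z'|w]; rewrite ?mulr //.
move: y; apply: tpow_linear_eq => [a z z'|a z z'|v]; rewrite ?mull ?mulr ?mull //.
move: x; apply: tpow_linear_eq => [a z z'|a z z'|u]; rewrite ?mull //.
rewrite !tpow_mul_pure; congr tpure; apply: eq_from_tnth => i.
by rewrite !tnth_mktuple mulrA.
Qed.

HB.instance Definition _ := GRing.Zmodule_isPzRing.Build (tpow n H)
  tpow_mulA tpow_mul1 tpow_mulr1 tpow_mulDl tpow_mulDr.

Lemma tpure_mul (u v : n.-tuple H) :
  tpure u * tpure v = tpure [tuple tnth u i * tnth v i | i < n].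
Proof. exact: tpow_mul_pure. Qed.

End AlgebraPower.

(* Restriction of scalars along k -> H, a |-> a%:A. *)
Definition restr (k : fieldType) (H : algType k) (V : lmodType H) : Type := V.

Section Restriction.
Variables (k : fieldType) (H : algType k) (V : lmodType H).

HB.instance Definition _ := GRing.Zmodule.on (restr V).

Definition restr_scale (a : k) (v : restr V) : restr V := (a%:A : H) *: (v : V).

Fact restr_scaleA a b v :
  restr_scale a (restr_scale b v) = restr_scale (a * b) v.
Proof. by rewrite /restr_scale scalerA -scalerAl mul1r scalerA. Qed.

Fact restr_scale1 : left_id 1 restr_scale.
Proof. by move=> v; rewrite /restr_scale !scale1r. Qed.

Fact restr_scaleDr : right_distributive restr_scale +%R.
Proof. by move=> a u v; rewrite /restr_scale scalerDr. Qed.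

Fact restr_scaleDl v : {morph restr_scale^~ v : a b / a + b}.
Proof. by move=> a b; rewrite /restr_scale !scalerDl. Qed.

HB.instance Definition _ := GRing.Zmodule_isLmodule.Build k (restr V)
  restr_scaleA restr_scale1 restr_scaleDr restr_scaleDl.

Definition restr_act (h : H) (v : restr V) : restr V := h *: (v : V).

Fact restr_act_bilinear : bilinear_for *:%R *:%R restr_act.
Proof.
split=> [v a g h | h a u v].
  rewrite /restr_act /= scalerDl; congr (_ + _).
  by rewrite [RHS]scalerA -scalerAl mul1r.
rewrite /restr_act scalerDr; congr (_ + _).
by rewrite [LHS]scalerA [RHS]scalerA -scalerAl mul1r -scalerAr mulr1.
Qed.

Definition tact (n : nat) :
    tpow n H -> tpow n (restr V) -> tpow n (restr V) :=
  tmap2 restr_act_bilinear.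

Lemma tact_pure n (h : n.-tuple H) (v : n.-tuple (restr V)) :
  tact (tpure h) (tpure v) =
  tpure [tuple restr_act (tnth h i) (tnth v i) | i < n].
Proof. exact: tmap2_pure. Qed.

End Restriction.

(* The 0-based i : 'I_n.-1 names the pair of adjacent slots i, i + 1. *)
Section Insertion.
Variables (n : nat) (i : 'I_n.-1).

Definition slot0 : 'I_n := widen_ord (leq_pred n) i.

Fact slot1_subproof : (i.+1 < n)%N.
Proof. by rewrite -ltn_predRL. Qed.
Definition slot1 : 'I_n := Ordinal slot1_subproof.

Lemma slot01 : slot0 != slot1.
Proof. by rewrite -val_eqE /= neq_ltn ltnSn. Qed.

Variables (k : fieldType) (V : lmodType k) (v : n.-tuple V).

Fact tinsert_bilinear : bilinear_for *:%R *:%R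
  (fun x y : V => tpure (tset (tset v slot0 x) slot1 y)).
Proof.
split=> z a x y /=; last by rewrite tpure_multilinear.
have E u : tset (tset v slot0 u) slot1 z = tset (tset v slot1 z) slot0 u.
  apply: eq_from_tnth => j; rewrite !tnth_tset.
  by case: (eqVneq j slot1) => [->|//]; rewrite eq_sym (negPf slot01).
by rewrite !E tpure_multilinear.
Qed.

(* w |-> v_1 (x) ... (x) v_{i-1} (x) w (x) v_{i+2} (x) ... (x) v_n: the entries
   of v in the two slots are discarded. *)
Definition tinsert : tpow 2 V -> tpow n V := blift tinsert_bilinear.

Lemma tinsert_pure x y : tinsert (tpure [tuple x; y]) =
  tpure (tset (tset v slot0 x) slot1 y).
Proof. exact: blift_pure. Qed.

End Insertion.

Section Legs.
Variables (k : fieldType) (H : algType k).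

Fact tflip_bilinear :
  bilinear_for *:%R *:%R (fun x y : H => tpure [tuple y; x]).
Proof.
split=> z.
  apply: (@tpure_linear _ _ _ _ [tuple z; 0] ord_max) => x.
  by apply: eq_from_tnth => j; rewrite tnth_tset; case: j => [[|[|j]] hj].
apply: (@tpure_linear _ _ _ _ [tuple 0; z] ord0) => x.
by apply: eq_from_tnth => j; rewrite tnth_tset; case: j => [[|[|j]] hj].
Qed.

Definition tflip : tpow 2 H -> tpow 2 H := blift tflip_bilinear.

Fact leg13_bilinear :
  bilinear_for *:%R *:%R (fun x y : H => tpure [tuple x; 1; y]).
Proof.
split=> z.
  apply: (@tpure_linear _ _ _ _ [tuple 0; 1; z] ord0) => x.
  by apply: eq_from_tnth => j; rewrite tnth_tset; case: j => [[|[|[|j]]] hj].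
apply: (@tpure_linear _ _ _ _ [tuple z; 1; 0] ord_max) => x.
by apply: eq_from_tnth => j; rewrite tnth_tset; case: j => [[|[|[|j]]] hj].
Qed.

Lemma tflip_pure x y : tflip (tpure [tuple x; y]) = tpure [tuple y; x].
Proof. exact: blift_pure. Qed.

Definition leg12 (A : tpow 2 H) : tpow 3 H := tcat A (1 : tpow 1 H).
Definition leg23 (A : tpow 2 H) : tpow 3 H := tcat (1 : tpow 1 H) A.
Definition leg13 : tpow 2 H -> tpow 3 H := blift leg13_bilinear.

Lemma leg13_pure x y : leg13 (tpure [tuple x; y]) = tpure [tuple x; 1; y].
Proof. exact: blift_pure. Qed.

Fact tpure1_linear : linear (fun x : H => tpure [tuple x]).
Proof.
apply: (@tpure_linear _ _ _ _ [tuple 0] ord0) => x.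
by apply: eq_from_tnth => j; rewrite tnth_tset; case: j => [[|j] hj].
Qed.

Variables (D : {linear H -> tpow 2 H}) (e : {linear H -> k | *%R}).

Fact comul_id_bilinear : bilinear_for *:%R *:%R
  (fun x y : H => tcat (D x) (tpure [tuple y])).
Proof.
split=> z a x y /=; first by rewrite linearP tcat_linearl.
by rewrite tpure1_linear tcat_linearr.
Qed.

Fact id_comul_bilinear : bilinear_for *:%R *:%R
  (fun x y : H => tcat (tpure [tuple x]) (D y)).
Proof.
split=> z a x y /=; first by rewrite tpure1_linear tcat_linearl.
by rewrite linearP tcat_linearr.
Qed.

Fact counit_id_bilinear : bilinear_for *:%R *:%R (fun x y : H => e x *: y).
Proof.
split=> z a x y /=; first by rewrite linearP scalerDl scalerA.
by rewrite scalerDr !scalerA mulrC.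
Qed.

Fact id_counit_bilinear : bilinear_for *:%R *:%R (fun x y : H => e y *: x).
Proof.
split=> z a x y /=; last by rewrite linearP scalerDl scalerA.
by rewrite scalerDr !scalerA mulrC.
Qed.

Definition comul_id : tpow 2 H -> tpow 3 H := blift comul_id_bilinear.
Definition id_comul : tpow 2 H -> tpow 3 H := blift id_comul_bilinear.

(* Here k (x) H and H (x) k are identified with H. *)
Definition counit_id : tpow 2 H -> H := blift counit_id_bilinear.
Definition id_counit : tpow 2 H -> H := blift id_counit_bilinear.

End Legs.

Record bialgebra (k : fieldType) (H : algType k) := Bialgebra {
  comul : {lrmorphism H -> tpow 2 H | *:%R};
  counit : {lrmorphism H -> k | *%R};
  comulA : forall h, comul_id comul (comul h) = id_comul comul (comul h);
  counit_idK : forall h, counit_id counit (comul h) = h;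
  id_counitK : forall h, id_counit counit (comul h) = h
}.

Record quasitriangular (k : fieldType) (H : algType k) (B : bialgebra H) :=
  Quasitriangular {
  Rmat : tpow 2 H;
  Rinv : tpow 2 H;
  RmatV : Rmat * Rinv = 1;
  RinvK : Rinv * Rmat = 1;
  tflip_comul : forall h, tflip (comul B h) = Rmat * comul B h * Rinv;
  id_comul_Rmat : id_comul (comul B) Rmat = leg13 Rmat * leg12 Rmat;
  comul_id_Rmat : comul_id (comul B) Rmat = leg13 Rmat * leg23 Rmat
}.

Record pre_cartier (k : fieldType) (H : algType k) (B : bialgebra H)
    (Q : quasitriangular B) := PreCartier {
  chi : tpow 2 H;
  chi_comul : forall h, chi * comul B h = comul B h * chi;
  id_comul_chi : id_comul (comul B) chi =
    leg12 chi + leg12 (Rinv Q) * leg13 chi * leg12 (Rmat Q);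
  comul_id_chi : comul_id (comul B) chi =
    leg23 chi + leg23 (Rinv Q) * leg13 chi * leg23 (Rmat Q)
}.

Record endo (k : fieldType) (V : lmodType k) := Endo {
  endo_fun :> V -> V;
  endo_linear : linear endo_fun
}.

Section EndoRing.
Variables (k : fieldType) (V : lmodType k).
Local Notation endo := (endo V).

HB.instance Definition _ := gen_eqMixin endo.
HB.instance Definition _ := gen_choiceMixin endo.

Lemma endoP (f g : endo) : f =1 g -> f = g.
Proof.
case: f g => [f hf] [g hg] /= /funext fg.
by case: _ / fg in hg *; congr Endo; exact: Prop_irrelevance.
Qed.

HB.instance Definition _ (f : endo) :=
  GRing.isLinear.Build k V V _ (endo_fun f) (endo_linear f).

Definition endo_zero : endo := Endo (GRing.linearP (\0 : {linear V -> V})).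
Definition endo_opp (f : endo) : endo :=
  Endo (GRing.linearP (\- (f : {linear V -> V}) : {linear V -> V})).
Definition endo_add (f g : endo) : endo :=
  Endo (GRing.linearP ((f : {linear V -> V}) \+ (g : {linear V -> V}) : {linear V -> V})).
Definition endo_one : endo := Endo (GRing.linearP (idfun : {linear V -> V})).
Definition endo_mul (f g : endo) : endo :=
  Endo (GRing.linearP ((f : {linear V -> V}) \o (g : {linear V -> V}) : {linear V -> V})).

Fact endo_addA : associative endo_add.
Proof. by move=> f g h; apply: endoP => x; exact: addrA. Qed.
Fact endo_addC : commutative endo_add.
Proof. by move=> f g; apply: endoP => x; exact: addrC. Qed.
Fact endo_add0 : left_id endo_zero endo_add.
Proof. by move=> f; apply: endoP => x; exact: add0r. Qed.
Fact endo_addN : left_inverse endo_zero endo_opp endo_add.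
Proof. by move=> f; apply: endoP => x; exact: addNr. Qed.

HB.instance Definition _ :=
  GRing.isZmodule.Build endo endo_addA endo_addC endo_add0 endo_addN.

Fact endo_mulA : associative endo_mul.
Proof. by move=> f g h; apply: endoP. Qed.
Fact endo_mul1 : left_id endo_one endo_mul.
Proof. by move=> f; apply: endoP. Qed.
Fact endo_mulr1 : right_id endo_one endo_mul.
Proof. by move=> f; apply: endoP. Qed.
Fact endo_mulDl : left_distributive endo_mul +%R.
Proof. by move=> f g h; apply: endoP. Qed.
Fact endo_mulDr : right_distributive endo_mul +%R.
Proof. by move=> f g h; apply: endoP => x; exact: (linearD f). Qed.

HB.instance Definition _ := GRing.Zmodule_isPzRing.Build endo
  endo_mulA endo_mul1 endo_mulr1 endo_mulDl endo_mulDr.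

End EndoRing.

Inductive rterm (X : Type) : Type :=
| RGen of X
| RZero
| ROne
| ROpp of rterm X
| RAdd of rterm X & rterm X
| RMul of rterm X & rterm X.

Arguments RZero {X}.
Arguments ROne {X}.

Declare Scope rterm_scope.
Delimit Scope rterm_scope with RT.
Notation "s + t" := (RAdd s t) : rterm_scope.
Notation "s * t" := (RMul s t) : rterm_scope.
Notation "- s" := (ROpp s) : rterm_scope.
Notation "0" := RZero : rterm_scope.
Notation "1" := ROne : rterm_scope.

HB.instance Definition _ (X : Type) := gen_eqMixin (rterm X).
HB.instance Definition _ (X : Type) := gen_choiceMixin (rterm X).

Section Presentation.
Variables (X : Type) (rel : rterm X -> rterm X -> Prop).

Inductive rcong : rterm X -> rterm X -> Prop :=
| rcong_rel s t : rel s t -> rcong s t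
| rcong_refl s : rcong s s
| rcong_sym s t : rcong s t -> rcong t s
| rcong_trans s t u : rcong s t -> rcong t u -> rcong s u
| rcong_opp s t : rcong s t -> rcong (- s)%RT (- t)%RT
| rcong_add s s' t t' :
    rcong s s' -> rcong t t' -> rcong (s + t)%RT (s' + t')%RT
| rcong_mul s s' t t' :
    rcong s s' -> rcong t t' -> rcong (s * t)%RT (s' * t')%RT
| rcong_addA s t u : rcong (s + (t + u))%RT ((s + t) + u)%RT
| rcong_addC s t : rcong (s + t)%RT (t + s)%RT
| rcong_add0 s : rcong (0 + s)%RT s
| rcong_addN s : rcong (- s + s)%RT 0%RT
| rcong_mulA s t u : rcong (s * (t * u))%RT ((s * t) * u)%RT
| rcong_mul1 s : rcong (1 * s)%RT s
| rcong_mulr1 s : rcong (s * 1)%RT s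
| rcong_mulDl s t u : rcong ((s + t) * u)%RT (s * u + t * u)%RT
| rcong_mulDr s t u : rcong (s * (t + u))%RT (s * t + s * u)%RT.

Definition rcongb (s t : rterm X) : bool := `[< rcong s t >].

Lemma rcongb_refl : reflexive rcongb.
Proof. by move=> s; apply/asboolP; exact: rcong_refl. Qed.

Lemma rcongb_sym : symmetric rcongb.
Proof. by move=> s t; apply/asboolP/asboolP; exact: rcong_sym. Qed.

Lemma rcongb_trans : transitive rcongb.
Proof.
by move=> t s u /asboolP st /asboolP tu; apply/asboolP; exact: rcong_trans tu.
Qed.

Canonical rcong_equiv := EquivRel rcongb rcongb_refl rcongb_sym rcongb_trans.

Definition presented := {eq_quot rcong_equiv}.

HB.instance Definition _ := Choice.on presented.
HB.instance Definition _ := Quotient.on presented.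
HB.instance Definition _ := EqQuotient.on presented.

Definition rclass (s : rterm X) : presented := \pi_presented s.

Lemma rclassK x : rclass (repr x) = x.
Proof. exact: reprK. Qed.

Lemma rclassP s t : rcong s t <-> rclass s = rclass t.
Proof. by split=> [h|/eqquotP/asboolP //]; apply/eqquotP/asboolP. Qed.

Lemma rcong_repr s : rcong (repr (rclass s)) s.
Proof. by apply/rclassP; rewrite rclassK. Qed.

Definition pres_opp (x : presented) : presented := rclass (- repr x)%RT.
Definition pres_add (x y : presented) : presented :=
  rclass (repr x + repr y)%RT.
Definition pres_mul (x y : presented) : presented :=
  rclass (repr x * repr y)%RT.

Lemma pres_oppE s : pres_opp (rclass s) = rclass (- s)%RT.
Proof. by apply/rclassP; apply: rcong_opp; exact: rcong_repr. Qed.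

Lemma pres_addE s t : pres_add (rclass s) (rclass t) = rclass (s + t)%RT.
Proof. by apply/rclassP; apply: rcong_add; exact: rcong_repr. Qed.

Lemma pres_mulE s t : pres_mul (rclass s) (rclass t) = rclass (s * t)%RT.
Proof. by apply/rclassP; apply: rcong_mul; exact: rcong_repr. Qed.

Lemma presW (P : presented -> Prop) : (forall s, P (rclass s)) -> forall x, P x.
Proof. by move=> h x; rewrite -[x]rclassK. Qed.

Fact pres_addA : associative pres_add.
Proof.
elim/presW=> s; elim/presW=> t; elim/presW=> u.
rewrite (pres_addE t) (pres_addE s t) (pres_addE s) (pres_addE (s + t)%RT).
by apply/rclassP; exact: rcong_addA.
Qed.

Fact pres_addC : commutative pres_add.
Proof.
elim/presW=> s; elim/presW=> t; rewrite (pres_addE s) (pres_addE t).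
by apply/rclassP; exact: rcong_addC.
Qed.

Fact pres_add0 : left_id (rclass 0%RT) pres_add.
Proof.
by elim/presW=> s; rewrite pres_addE; apply/rclassP; exact: rcong_add0.
Qed.

Fact pres_addN : left_inverse (rclass 0%RT) pres_opp pres_add.
Proof.
elim/presW=> s; rewrite (pres_oppE s) (pres_addE (- s)%RT).
by apply/rclassP; exact: rcong_addN.
Qed.

HB.instance Definition _ :=
  GRing.isZmodule.Build presented pres_addA pres_addC pres_add0 pres_addN.

Fact pres_mulA : associative pres_mul.
Proof.
elim/presW=> s; elim/presW=> t; elim/presW=> u.
rewrite (pres_mulE t) (pres_mulE s t) (pres_mulE s) (pres_mulE (s * t)%RT).
by apply/rclassP; exact: rcong_mulA.
Qed.

Fact pres_mul1 : left_id (rclass 1%RT) pres_mul.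
Proof.
by elim/presW=> s; rewrite pres_mulE; apply/rclassP; exact: rcong_mul1.
Qed.

Fact pres_mulr1 : right_id (rclass 1%RT) pres_mul.
Proof.
by elim/presW=> s; rewrite pres_mulE; apply/rclassP; exact: rcong_mulr1.
Qed.

Fact pres_mulDl : left_distributive pres_mul pres_add.
Proof.
elim/presW=> s; elim/presW=> t; elim/presW=> u.
rewrite (pres_addE s) (pres_mulE s) (pres_mulE t) (pres_mulE (s + t)%RT).
rewrite (pres_addE (s * u)%RT).
by apply/rclassP; exact: rcong_mulDl.
Qed.

Fact pres_mulDr : right_distributive pres_mul pres_add.
Proof.
elim/presW=> s; elim/presW=> t; elim/presW=> u.
rewrite (pres_addE t) (pres_mulE s t) (pres_mulE s u) (pres_mulE s).
rewrite (pres_addE (s * t)%RT).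
by apply/rclassP; exact: rcong_mulDr.
Qed.

HB.instance Definition _ := GRing.Zmodule_isPzRing.Build presented
  pres_mulA pres_mul1 pres_mulr1 pres_mulDl pres_mulDr.

Definition pgen (x : X) : presented := rclass (RGen x).

Fixpoint reval (S : pzRingType) (f : X -> S) (s : rterm X) : S :=
  match s with
  | RGen x => f x
  | RZero => 0
  | ROne => 1
  | ROpp s => - reval f s
  | RAdd s t => reval f s + reval f t
  | RMul s t => reval f s * reval f t
  end.

Definition pres_lift (S : pzRingType) (f : X -> S)
    (hf : forall s t, rel s t -> reval f s = reval f t) (x : presented) : S :=
  reval f (repr x).

Section Universal.
Variables (S : pzRingType) (f : X -> S).
Hypothesis hf : forall s t, rel s t -> reval f s = reval f t.

Lemma reval_cong s t : rcong s t -> reval f s = reval f t.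
Proof.
elim=> {s t} /=.
- exact: hf.
- by [].
- by [].
- by move=> s t u _ -> _ ->.
- by move=> s t _ ->.
- by move=> s s' t t' _ -> _ ->.
- by move=> s s' t t' _ -> _ ->.
- by move=> *; rewrite addrA.
- by move=> *; rewrite addrC.
- by move=> *; rewrite add0r.
- by move=> *; rewrite addNr.
- by move=> *; rewrite mulrA.
- by move=> *; rewrite mul1r.
- by move=> *; rewrite mulr1.
- by move=> *; rewrite mulrDl.
- by move=> *; rewrite mulrDr.
Qed.

Lemma pres_lift_class s : pres_lift hf (rclass s) = reval f s.
Proof. exact/reval_cong/rcong_repr. Qed.

Fact pres_lift_zmod : zmod_morphism (pres_lift hf).
Proof.
elim/presW=> s; elim/presW=> t; rewrite [- _]pres_oppE [_ + _]pres_addE.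
by rewrite !pres_lift_class.
Qed.

Fact pres_lift_monoid : monoid_morphism (pres_lift hf).
Proof.
split; first exact: pres_lift_class.
elim/presW=> s; elim/presW=> t; rewrite [_ * _]pres_mulE.
by rewrite !pres_lift_class.
Qed.

HB.instance Definition _ :=
  GRing.isZmodMorphism.Build presented S (pres_lift hf) pres_lift_zmod.
HB.instance Definition _ :=
  GRing.isMonoidMorphism.Build presented S (pres_lift hf) pres_lift_monoid.

Lemma pres_lift_gen x : pres_lift hf (pgen x) = f x.
Proof. exact: pres_lift_class. Qed.

Lemma pres_lift_uniq (rho : {rmorphism presented -> S}) :
  (forall x, rho (pgen x) = f x) -> rho =1 pres_lift hf.
Proof.
move=> rhoE; elim/presW; elim=> [x|||s IH|s IHs t IHt|s IHs t IHt].
- by rewrite pres_lift_gen -rhoE.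
- by rewrite pres_lift_class; exact: rmorph0.
- by rewrite pres_lift_class; exact: rmorph1.
- rewrite pres_lift_class /= -pres_lift_class -IH -rmorphN.
  by congr (rho _); rewrite [RHS]pres_oppE.
- rewrite pres_lift_class /= -!pres_lift_class -IHs -IHt -rmorphD.
  by congr (rho _); rewrite [RHS]pres_addE.
- rewrite pres_lift_class /= -!pres_lift_class -IHs -IHt -rmorphM.
  by congr (rho _); rewrite [RHS]pres_mulE.
Qed.

End Universal.
End Presentation.

(* Generators are numbered from 0; beta_i^-1 is a generator of its own, tied to
   beta_i by the first two relations below. *)
Inductive cartier_gen (n : nat) : Type :=
| GBeta of 'I_n.-1
| GBetaInv of 'I_n.-1
| GGamma of 'I_n.-1.

Definition far (n : nat) (i j : 'I_n) : bool := (i.+2 <= j)%N || (j.+2 <= i)%N.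

Section CartierRing.
Variable n : nat.
Local Notation b i := (RGen (GBeta i)).
Local Notation b' i := (RGen (GBetaInv i)).
Local Notation c i := (RGen (GGamma i)).
Local Open Scope rterm_scope.

Inductive cartier_rel :
    rterm (cartier_gen n) -> rterm (cartier_gen n) -> Prop :=
| cartier_invr (i : 'I_n.-1) : cartier_rel (b i * b' i) 1
| cartier_invl (i : 'I_n.-1) : cartier_rel (b' i * b i) 1
| cartier_bb (i j : 'I_n.-1) : far i j -> cartier_rel (b i * b j) (b j * b i)
| cartier_cc (i j : 'I_n.-1) : far i j -> cartier_rel (c i * c j) (c j * c i)
| cartier_bc (i j : 'I_n.-1) : far i j -> cartier_rel (b i * c j) (c j * b i)
| cartier_braid (i j : 'I_n.-1) : j = i.+1 :> nat ->
    cartier_rel (b i * b j * b i) (b j * b i * b j)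
| cartier_cartier (i j : 'I_n.-1) : j = i.+1 :> nat ->
    cartier_rel
      (b i * (c i * b j + b j * c j) * b i + b i * b j * b i * c i)
      (b j * (c j * b i + b i * c i) * b j + b j * b i * b j * c j).

Definition cartier_ring := presented cartier_rel.

HB.instance Definition _ := GRing.PzRing.on cartier_ring.

Definition beta (i : 'I_n.-1) : cartier_ring := pgen cartier_rel (GBeta i).
Definition gamma (i : 'I_n.-1) : cartier_ring := pgen cartier_rel (GGamma i).

End CartierRing.

(* Main.v *)
Require Import Defs.
From mathcomp Require Import all_boot all_algebra.
From mathcomp Require Import fingroup perm zify.

Set Implicit Arguments.
Unset Strict Implicit.
Unset Printing Implicit Defensive.

Import GRing.Theory.
Local Open Scope ring_scope.

(** Write [s_i] for the endomorphism of the tensor power that swaps the slots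
    [i] and [i + 1], and [X_pq] for the action of [X : tpow 2 H] in the slots
    [p] and [q].  Acting with the flipped R-matrix on flipped arguments is the
    same as acting with the R-matrix and flipping afterwards, so the two
    families of operators are [beta_i = s_i R_(i,i+1)] and
    [gamma_i = chi_(i,i+1)], and [beta_i] has inverse [Rinv_(i,i+1) s_i].

    Since [X_pq s = s X_(s p, s q)] for every transposition [s], all swaps can
    be pulled to the left.  Generators that are far apart then commute because
    they live in disjoint slots ([legs_comm], [leg2_perm]).  For adjacent
    generators both sides of a relation begin with the same permutation
    [s_1 s_2 s_1 = s_2 s_1 s_2], and what is left is an identity in the
    threefold tensor power of [H] ([braid_of_ybe], [cartier_of_cube]).  Writing
    [D] for the coproduct, the identity left by the braid relation is the
    quantum Yang-Baxter equation
      [R12 R13 R23 = R23 R13 R12]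
    ([qybe]), and the one left by the other relation is
      [R23 X23 R13 R12 + R23 R13 X13 R12 + R23 R13 R12 X12
       = R12 X12 R13 R23 + R12 R13 X13 R23 + R12 R13 R23 X23]
    for [X = chi] ([cartier_cube]).  The outer terms match in pairs: [X12]
    commutes with [(D (x) id) R = R13 R23] and [X23] commutes with
    [(id (x) D) R = R13 R12], because [chi] commutes with coproducts, and the
    Yang-Baxter equation does the rest.  The middle terms match because
      [R12 (R23^-1 X13 R23) = X13 R12].
    This last fact comes from applying [R12 (D (x) id) = (D^op (x) id) R12] to
    [chi], which reads
      [R12 (X23 + R23^-1 X13 R23) = (X13 + R13^-1 X23 R13) R12],
    and cancelling [R12 X23 = R13^-1 X23 R13 R12]. *)

(** * Linear maps on tensor powers *)

Lemma linear_id (k : fieldType) (U : lmodType k) : linear (fun x : U => x).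
Proof. by []. Qed.

Lemma linear_comp (k : fieldType) (U V W : lmodType k)
    (f : V -> W) (g : U -> V) :
  linear f -> linear g -> linear (fun x => f (g x)).
Proof. by move=> hf hg a x y; rewrite hg hf. Qed.

Lemma tpow2_linear_eq (k : fieldType) (V W : lmodType k)
    (f g : tpow 2 V -> W) :
  linear f -> linear g ->
  (forall x y, f (tpure [tuple x; y]) = g (tpure [tuple x; y])) -> f =1 g.
Proof.
move=> lf lg fg; apply: tpow_linear_eq => // v.
have -> // : v = [tuple tnth v ord0; tnth v ord_max].
apply: eq_from_tnth => -[[|[|i]] hi] //;
  rewrite [RHS](tnth_nth (tnth v ord0)) /=; congr tnth; exact: val_inj.
Qed.

Lemma blift_linear (k : fieldType) (V W : lmodType k) (b : V -> V -> W)
    (hb : bilinear_for *:%R *:%R b) : linear (blift hb).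
Proof. exact: tlift_linear. Qed.

Section Multiplication.
Variables (k : fieldType) (H : algType k).

Lemma tmul_linearl n (b : tpow n H) :
  linear (fun a : tpow n H => a * b : tpow n H).
Proof. exact: tlift2_linearl. Qed.

Lemma tmul_linearr n (a : tpow n H) :
  linear (fun b : tpow n H => a * b : tpow n H).
Proof. exact: tlift2_linearr. Qed.

Lemma tcat_mul m n (a a' : tpow m H) (b b' : tpow n H) :
  tcat a b * tcat a' b' = tcat (a * a') (b * b').
Proof.
move: a; apply: tpow_linear_eq => [||u].
- exact: linear_comp (tmul_linearl _) (tcat_linearl _).
- exact: linear_comp (tcat_linearl _) (tmul_linearl _).
move: b; apply: tpow_linear_eq => [||v].
- exact: linear_comp (tmul_linearl _) (tcat_linearr _).
- exact: linear_comp (tcat_linearr _) (tmul_linearl _).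
move: a'; apply: tpow_linear_eq => [||u'].
- exact: linear_comp (tmul_linearr _) (tcat_linearl _).
- exact: linear_comp (tcat_linearl _) (tmul_linearr _).
move: b'; apply: tpow_linear_eq => [||v'].
- exact: linear_comp (tmul_linearr _) (tcat_linearr _).
- exact: linear_comp (tcat_linearr _) (tmul_linearr _).
rewrite !tcat_pure !tpure_mul tcat_pure; congr tpure.
apply: eq_from_tnth => j; rewrite tnth_mktuple.
by case: (split_ordP j) => i ->; rewrite ?tnth_lshift ?tnth_rshift tnth_mktuple.
Qed.

End Multiplication.

(** * Embeddings of tensor powers by a choice of slots *)

Section Slots.
Variables (k : fieldType) (H : algType k) (n : nat).

(** [index j s] is [m] when [j] is not in [s], so the default value of [nth]
    puts a unit in every slot outside [s]. *)
Definition spread m (s : m.-tuple 'I_n) (u : m.-tuple H) : n.-tuple H :=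
  [tuple nth 1 u (index j s) | j < n].

Lemma tnth_spread m (s : m.-tuple 'I_n) u i :
  uniq s -> tnth (spread s u) (tnth s i) = tnth u i.
Proof.
move=> us; rewrite tnth_mktuple (tnth_nth (tnth s i) s).
by rewrite index_uniq ?size_tuple // -tnth_nth.
Qed.

Lemma tnth_spread_out m (s : m.-tuple 'I_n) u j :
  j \notin s -> tnth (spread s u) j = 1.
Proof.
by move=> js; rewrite tnth_mktuple nth_default // memNindex // !size_tuple.
Qed.

Lemma spread_tset m (s : m.-tuple 'I_n) u i x : uniq s ->
  spread s (tset u i x) = tset (spread s u) (tnth s i) x.
Proof.
move=> us; apply: eq_from_tnth => j; rewrite tnth_tset.
have [/tnthP[i' ->]|js] := boolP (j \in s).
  by rewrite !tnth_spread // tnth_tset (inj_eq (tuple_uniqP _ us)).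
rewrite !tnth_spread_out //; case: eqP => // E.
by rewrite E mem_tnth in js.
Qed.

Lemma spread_mul m (s : m.-tuple 'I_n) u v : uniq s ->
  spread s [tuple tnth u i * tnth v i | i < m] =
  [tuple tnth (spread s u) j * tnth (spread s v) j | j < n].
Proof.
move=> us; apply: eq_from_tnth => j; rewrite [RHS]tnth_mktuple.
have [/tnthP[i ->]|js] := boolP (j \in s).
  by rewrite !tnth_spread // tnth_mktuple.
by rewrite !tnth_spread_out // mulr1.
Qed.

Fact legs_multilinear m (s : m.-tuple 'I_n) : uniq s ->
  multilinear (fun u => tpure (spread s u)).
Proof. by move=> us u i a x y; rewrite !spread_tset // tpure_multilinear. Qed.

(** The algebra map from the [m]-fold to the [n]-fold tensor power that puts
    the [i]-th factor in slot [tnth s i]; it specialises to the leg notations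
    [X12], [X13] and [X23], and to permutations of the factors.  Distinctness
    of the slots is what makes it linear and multiplicative. *)
Definition legs m (s : m.-tuple 'I_n) (us : uniq s) : tpow m H -> tpow n H :=
  tlift (legs_multilinear us).

Section OneTuple.
Variables (m : nat) (s : m.-tuple 'I_n) (us : uniq s).

Lemma legs_pure u : legs us (tpure u) = tpure (spread s u).
Proof. exact: tlift_pure. Qed.

Lemma legs_linear : linear (legs us).
Proof. exact: tlift_linear. Qed.

Lemma legsD A B : legs us (A + B) = legs us A + legs us B.
Proof. by have := legs_linear 1 A B; rewrite !scale1r. Qed.

Lemma legs1 : legs us 1 = 1.
Proof.
rewrite legs_pure; congr tpure; apply: eq_from_tnth => j.
rewrite [RHS]tnth_mktuple.
have [/tnthP[i ->]|js] := boolP (j \in s).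
  by rewrite tnth_spread // tnth_mktuple.
by rewrite tnth_spread_out.
Qed.

Lemma legsM A B : legs us (A * B) = legs us A * legs us B.
Proof.
move: A; apply: tpow_linear_eq => [||u].
- exact: linear_comp legs_linear (tmul_linearl _).
- exact: linear_comp (tmul_linearl _) legs_linear.
move: B; apply: tpow_linear_eq => [||v].
- exact: linear_comp legs_linear (tmul_linearr _).
- exact: linear_comp (tmul_linearr _) legs_linear.
by rewrite tpure_mul !legs_pure tpure_mul spread_mul.
Qed.

End OneTuple.

Lemma eq_legs m (s t : m.-tuple 'I_n) (us : uniq s) (ut : uniq t) :
  val s = val t -> legs us =1 legs ut.
Proof.
move=> /val_inj st; case: _ / st in ut *.
by rewrite (bool_irrelevance us ut).
Qed.

(** In each slot at least one of the two factors is [1]. *)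
Lemma legs_comm m p (s : m.-tuple 'I_n) (t : p.-tuple 'I_n)
    (us : uniq s) (ut : uniq t) A B : ~~ has (mem s) t ->
  legs us A * legs ut B = legs ut B * legs us A.
Proof.
move=> st.
move: A; apply: tpow_linear_eq => [||u].
- exact: linear_comp (tmul_linearl _) (legs_linear us).
- exact: linear_comp (tmul_linearr _) (legs_linear us).
move: B; apply: tpow_linear_eq => [||v].
- exact: linear_comp (tmul_linearr _) (legs_linear ut).
- exact: linear_comp (tmul_linearl _) (legs_linear ut).
rewrite !legs_pure !tpure_mul; congr tpure.
apply: eq_from_tnth => j; rewrite [LHS]tnth_mktuple [RHS]tnth_mktuple.
have [js|js] := boolP (j \in s); last first.
  by rewrite !(@tnth_spread_out _ s) // mul1r mulr1.
have jt : j \notin t by apply: contra st => jt; apply/hasP; exists j.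
by rewrite !(@tnth_spread_out _ t) // mul1r mulr1.
Qed.

End Slots.

(** * The three legs in three slots *)

Section LegsLinear.
Variables (k : fieldType) (H : algType k).

Lemma leg12_linear : linear (@leg12 k H).
Proof. exact: (@tcat_linearl k 2 1 H 1). Qed.

Lemma leg23_linear : linear (@leg23 k H).
Proof. exact: (@tcat_linearr k 1 2 H 1). Qed.

Lemma leg13_linear : linear (@leg13 k H).
Proof. exact: tlift_linear. Qed.

End LegsLinear.

Section ThreeSlots.
Variables (k : fieldType) (H : algType k) (n : nat) (a b c : 'I_n).
Hypothesis abc : uniq [:: a; b; c].

Lemma uniq3_12 : uniq [:: a; b].
Proof. by move: abc; rewrite /= !inE !negb_or -!andbA => /and4P[-> _ _ _]. Qed.
Lemma uniq3_13 : uniq [:: a; c].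
Proof. by move: abc; rewrite /= !inE !negb_or -!andbA => /and4P[_ -> _ _]. Qed.
Lemma uniq3_23 : uniq [:: b; c].
Proof. by move: abc; rewrite /= !inE !negb_or -!andbA => /and4P[_ _ -> _]. Qed.

Let abcP : [/\ a != b, a != c & b != c].
Proof. by move: abc; rewrite /= !inE !negb_or -!andbA => /and4P[]. Qed.

Lemma tone1 : (1 : tpow 1 H) = tpure [tuple 1].
Proof.
congr tpure; apply: eq_from_tnth => i.
by rewrite tnth_mktuple (tnth_nth 0) ord1.
Qed.

Lemma leg12_pure (x y : H) : leg12 (tpure [tuple x; y]) = tpure [tuple x; y; 1].
Proof.
rewrite /leg12 tone1 tcat_pure; congr tpure.
by apply: eq_from_tnth => -[[|[|[|j]]] hj] //; rewrite !(tnth_nth 0).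
Qed.

Lemma leg23_pure (x y : H) : leg23 (tpure [tuple x; y]) = tpure [tuple 1; x; y].
Proof.
rewrite /leg23 tone1 tcat_pure; congr tpure.
by apply: eq_from_tnth => -[[|[|[|j]]] hj] //; rewrite !(tnth_nth 0).
Qed.

(** The next three lemmas transport identities between the legs of a threefold
    tensor power to any three slots of an [n]-fold one. *)
Lemma legs_leg12 (A : tpow 2 H) :
  @legs _ H _ _ [tuple a; b; c] abc (leg12 A) =
  @legs _ H _ _ [tuple a; b] uniq3_12 A.
Proof.
move: A; apply: tpow2_linear_eq => [||x y].
- exact: linear_comp (legs_linear _) (@leg12_linear _ _).
- exact: legs_linear.
rewrite leg12_pure !legs_pure; congr tpure; apply: eq_from_tnth => j.
rewrite !tnth_mktuple /=.
by case: eqP => //= _; case: eqP => //= _; case: eqP.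
Qed.

Lemma legs_leg13 (A : tpow 2 H) :
  @legs _ H _ _ [tuple a; b; c] abc (leg13 A) =
  @legs _ H _ _ [tuple a; c] uniq3_13 A.
Proof.
move: A; apply: tpow2_linear_eq => [||x y].
- exact: linear_comp (legs_linear _) (@leg13_linear _ _).
- exact: legs_linear.
rewrite leg13_pure !legs_pure; congr tpure; apply: eq_from_tnth => j.
rewrite !tnth_mktuple /=.
case: abcP => _ _ bc.
case: eqP => //= _; case: (eqVneq b j) => [<-|_] /=; last by case: eqP.
by rewrite eq_sym (negPf bc).
Qed.

Lemma legs_leg23 (A : tpow 2 H) :
  @legs _ H _ _ [tuple a; b; c] abc (leg23 A) =
  @legs _ H _ _ [tuple b; c] uniq3_23 A.
Proof.
move: A; apply: tpow2_linear_eq => [||x y].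
- exact: linear_comp (legs_linear _) (@leg23_linear _ _).
- exact: legs_linear.
rewrite leg23_pure !legs_pure; congr tpure; apply: eq_from_tnth => j.
rewrite !tnth_mktuple /=.
case: abcP => ab ac _.
case: (eqVneq a j) => [<-|_] /=; last by case: eqP.
by rewrite eq_sym (negPf ab) /= eq_sym (negPf ac).
Qed.

End ThreeSlots.

(** * Identities in the threefold tensor power *)

Section AbstractCartier.
Variable S : pzRingType.

(** Commuting [x23] past [r13 * r12] cancels its two occurrences in the last
    hypothesis and leaves [r12 * r23' * x13 * r23 = x13 * r12], which matches
    the middle terms; commutation and the Yang-Baxter equation match the others. *)
Lemma cartier_of_flip (r12 r13 r23 r13' r23' x12 x13 x23 : S) :
  r13' * r13 = 1 -> r13 * r13' = 1 -> r23 * r23' = 1 ->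
  r12 * r13 * r23 = r23 * r13 * r12 ->
  x12 * (r13 * r23) = r13 * r23 * x12 ->
  x23 * (r13 * r12) = r13 * r12 * x23 ->
  r12 * (x23 + r23' * x13 * r23) = (x13 + r13' * x23 * r13) * r12 ->
  r23 * x23 * r13 * r12 + r23 * r13 * x13 * r12 + r23 * r13 * r12 * x12 =
  r12 * x12 * r13 * r23 + r12 * r13 * x13 * r23 + r12 * r13 * r23 * x23.
Proof.
move=> V13 V13' V23 qybe c12 c23.
rewrite mulrDr mulrDl [RHS]addrC -[_ * r13 * r12]mulrA -[_ * (r13 * r12)]mulrA.
rewrite c23 !mulrA V13 mul1r => /addrI flip.
have -> : r23 * x23 * r13 * r12 = r12 * r13 * r23 * x23.
  by rewrite qybe -!mulrA c23 !mulrA.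
have -> : r23 * r13 * r12 * x12 = r12 * x12 * r13 * r23.
  by rewrite -qybe -!mulrA c12 !mulrA.
have -> : r23 * r13 * x13 * r12 = r12 * r13 * x13 * r23.
  rewrite -[LHS]mulrA -flip !mulrA -qybe -[r12 * r13 * r23 * r23']mulrA.
  by rewrite V23 mulr1.
by rewrite addrAC -addrA addrC addrAC addrC addrA.
Qed.

End AbstractCartier.

Section TensorCube.
Variables (k : fieldType) (H : algType k).

Notation o0 := (@Ordinal 3 0 isT).
Notation o1 := (@Ordinal 3 1 isT).
Notation o2 := (@Ordinal 3 2 isT).

Lemma legs_id (us : uniq [tuple o0; o1; o2]) : @legs _ H _ _ _ us =1 id.
Proof.
apply: tpow_linear_eq => [||u]; [exact: legs_linear | exact: linear_id |].
rewrite legs_pure; congr tpure; apply: eq_from_tnth => j.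
have {1}-> : j = tnth [tuple o0; o1; o2] j.
  by apply: val_inj; case: j => [[|[|[|j]]] hj]; rewrite //= (tnth_nth o0).
by rewrite tnth_spread.
Qed.

Lemma leg13E (A : tpow 2 H) :
  leg13 A = legs (isT : uniq [tuple o0; o2]) A.
Proof.
by rewrite -(legs_id isT (leg13 A)) legs_leg13; exact: eq_legs.
Qed.

Lemma leg23E (A : tpow 2 H) :
  leg23 A = legs (isT : uniq [tuple o1; o2]) A.
Proof.
by rewrite -(legs_id isT (leg23 A)) legs_leg23; exact: eq_legs.
Qed.

Definition flip12 : tpow 3 H -> tpow 3 H :=
  legs (isT : uniq [tuple o1; o0; o2]).

Lemma flip12D A A' : flip12 (A + A') = flip12 A + flip12 A'.
Proof. exact: legsD. Qed.

Lemma flip12M A A' : flip12 (A * A') = flip12 A * flip12 A'.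
Proof. exact: legsM. Qed.

Lemma flip12_leg13 A : flip12 (leg13 A) = leg23 A.
Proof. by rewrite /flip12 legs_leg13 leg23E; exact: eq_legs. Qed.

Lemma flip12_leg23 A : flip12 (leg23 A) = leg13 A.
Proof. by rewrite /flip12 legs_leg23 leg13E; exact: eq_legs. Qed.

Lemma flip12_tcat (A : tpow 2 H) y :
  flip12 (tcat A (tpure [tuple y])) = tcat (tflip A) (tpure [tuple y]).
Proof.
move: A; apply: tpow2_linear_eq => [||a b].
- exact: linear_comp (legs_linear _) (@tcat_linearl _ 2 1 _ _).
- exact: linear_comp (@tcat_linearl _ 2 1 _ _) (blift_linear _).
rewrite tflip_pure !tcat_pure [LHS]legs_pure; congr tpure.
apply: eq_from_tnth => -[[|[|[|j]]] hj] //;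
  by rewrite tnth_mktuple (tnth_nth 0).
Qed.

Variable (D : {linear H -> tpow 2 H}).

Lemma comul_id_linear : linear (comul_id D).
Proof. exact: tlift_linear. Qed.

Lemma id_comul_linear : linear (id_comul D).
Proof. exact: tlift_linear. Qed.

Lemma comul_id_pure x y :
  comul_id D (tpure [tuple x; y]) = tcat (D x) (tpure [tuple y]).
Proof. exact: blift_pure. Qed.

Lemma id_comul_pure x y :
  id_comul D (tpure [tuple x; y]) = tcat (tpure [tuple x]) (D y).
Proof. exact: blift_pure. Qed.

Lemma leg12_tcat (A B : tpow 2 H) (b : tpow 1 H) :
  leg12 A * (tcat B b : tpow 3 H) = tcat (A * B) b.
Proof. by have := @tcat_mul k H 2 1 A B 1 b; rewrite mul1r. Qed.

Lemma tcat_leg12 (A B : tpow 2 H) (b : tpow 1 H) :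
  (tcat B b : tpow 3 H) * leg12 A = tcat (B * A) b.
Proof. by have := @tcat_mul k H 2 1 B A b 1; rewrite mulr1. Qed.

Lemma leg23_tcat (A B : tpow 2 H) (b : tpow 1 H) :
  leg23 A * (tcat b B : tpow 3 H) = tcat b (A * B).
Proof. by have := @tcat_mul k H 1 2 1 b A B; rewrite mul1r. Qed.

Lemma tcat_leg23 (A B : tpow 2 H) (b : tpow 1 H) :
  (tcat b B : tpow 3 H) * leg23 A = tcat b (B * A).
Proof. by have := @tcat_mul k H 1 2 b 1 B A; rewrite mulr1. Qed.

Lemma leg12_comul_id (X : tpow 2 H) :
  (forall h, X * D h = D h * X) ->
  forall A, leg12 X * comul_id D A = comul_id D A * leg12 X.
Proof.
move=> XD; apply: tpow2_linear_eq => [||x y].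
- exact: linear_comp (tmul_linearr _) comul_id_linear.
- exact: linear_comp (tmul_linearl _) comul_id_linear.
by rewrite comul_id_pure leg12_tcat XD tcat_leg12.
Qed.

Lemma leg23_id_comul (X : tpow 2 H) :
  (forall h, X * D h = D h * X) ->
  forall A, leg23 X * id_comul D A = id_comul D A * leg23 X.
Proof.
move=> XD; apply: tpow2_linear_eq => [||x y].
- exact: linear_comp (tmul_linearr _) id_comul_linear.
- exact: linear_comp (tmul_linearl _) id_comul_linear.
by rewrite id_comul_pure leg23_tcat XD tcat_leg23.
Qed.

(** This is [R12 (D (x) id) = (D^op (x) id) R12], whence both the Yang-Baxter
    equation, taking [A = R], and the behaviour of [chi], taking [A = chi]. *)
Lemma leg12_comul_id_flip (X : tpow 2 H) :
  (forall h, X * D h = tflip (D h) * X) ->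
  forall A, leg12 X * comul_id D A = flip12 (comul_id D A) * leg12 X.
Proof.
move=> XD; apply: tpow2_linear_eq => [||x y].
- exact: linear_comp (tmul_linearr _) comul_id_linear.
- apply: linear_comp (tmul_linearl _) _.
  exact: linear_comp (legs_linear _) comul_id_linear.
by rewrite comul_id_pure leg12_tcat XD flip12_tcat tcat_leg12.
Qed.

End TensorCube.

(** * Yang-Baxter and Cartier identities *)

Section PreCartier.
Variables (k : fieldType) (H : algType k) (B : bialgebra H)
  (Q : quasitriangular B).
Local Notation R := (Rmat Q).

Lemma Rmat_flip h : R * comul B h = tflip (comul B h) * R.
Proof. by rewrite (tflip_comul Q) -mulrA RinvK mulr1. Qed.

Lemma qybe : leg12 R * leg13 R * leg23 R = leg23 R * leg13 R * leg12 R.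
Proof.
have := leg12_comul_id_flip Rmat_flip R.
by rewrite comul_id_Rmat flip12M flip12_leg13 flip12_leg23 mulrA.
Qed.

(** With the Yang-Baxter equation, this says that
    [X23 + (id (x) D) X = X12 + (D (x) id) X], that is, [chi] is a Hochschild
    2-cocycle. *)
Lemma cartier_cube (C : pre_cartier Q) (X := chi C) :
  leg23 R * leg23 X * leg13 R * leg12 R + leg23 R * leg13 R * leg13 X * leg12 R
    + leg23 R * leg13 R * leg12 R * leg12 X =
  leg12 R * leg12 X * leg13 R * leg23 R + leg12 R * leg13 R * leg13 X * leg23 R
    + leg12 R * leg13 R * leg23 R * leg23 X.
Proof.
apply: (@cartier_of_flip _ _ _ _ (leg13 (Rinv Q)) (leg23 (Rinv Q))).
- by rewrite !leg13E -legsM RinvK legs1.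
- by rewrite !leg13E -legsM RmatV legs1.
- by rewrite !leg23E -legsM RmatV legs1.
- exact: qybe.
- by have := leg12_comul_id (chi_comul C) R; rewrite comul_id_Rmat.
- by have := leg23_id_comul (chi_comul C) R; rewrite id_comul_Rmat.
have := leg12_comul_id_flip Rmat_flip (chi C).
rewrite comul_id_chi flip12D 2!flip12M.
by rewrite flip12_leg13 !flip12_leg23.
Qed.

End PreCartier.

(** * Permutations and the tensor algebra acting on a tensor power *)

Lemma endo_mulE (k : fieldType) (V : lmodType k) (f g : endo V) x :
  (f * g) x = f (g x).
Proof. by []. Qed.

Section PermEndo.
Variables (k : fieldType) (n : nat) (V : lmodType k).

Definition perm_tuple (s : 'S_n) (v : n.-tuple V) : n.-tuple V :=
  [tuple tnth v (s j) | j < n].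

Fact perm_multilinear s : multilinear (fun v => tpure (perm_tuple s v)).
Proof.
move=> v i a x y.
have E z : perm_tuple s (tset v i z) = tset (perm_tuple s v) (s^-1%g i) z.
  apply: eq_from_tnth => j; rewrite tnth_tset !tnth_mktuple.
  by rewrite (can2_eq (permK s) (permKV s)).
by rewrite !E tpure_multilinear.
Qed.

Definition perm_endo (s : 'S_n) : endo (tpow n V) :=
  Endo (tlift_linear (perm_multilinear s)).

Lemma perm_endo_pure s v : perm_endo s (tpure v) = tpure (perm_tuple s v).
Proof. exact: tlift_pure. Qed.

Lemma endo_ext (f g : endo (tpow n V)) :
  (forall v, f (tpure v) = g (tpure v)) -> f = g.
Proof. by move=> fg; apply/endoP/tpow_linear_eq; [exact: endo_linear..|]. Qed.

Lemma perm_endoM s t : perm_endo (s * t)%g = perm_endo s * perm_endo t.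
Proof.
apply: endo_ext => v; rewrite endo_mulE !perm_endo_pure; congr tpure.
by apply: eq_from_tnth => j; rewrite !tnth_mktuple permM.
Qed.

Lemma perm_endo1 : perm_endo 1%g = 1.
Proof.
apply: endo_ext => v; rewrite perm_endo_pure; congr tpure.
by apply: eq_from_tnth => j; rewrite tnth_mktuple perm1.
Qed.

End PermEndo.

Section ActEndo.
Variables (k : fieldType) (H : algType k) (V : lmodType H) (n : nat).
Local Notation P := (@perm_endo k n (restr V)).

Definition act_endo (A : tpow n H) : endo (tpow n (restr V)) :=
  Endo (tmap2_linearr (@restr_act_bilinear k H V) A).

Lemma act_endoE A x : act_endo A x = tact A x.
Proof. by []. Qed.

Lemma tact_linearl m (x : tpow m (restr V)) :
  linear (fun A : tpow m H => tact A x).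
Proof. exact: tmap2_linearl. Qed.

Lemma tact_linearr m (A : tpow m H) :
  linear (fun x : tpow m (restr V) => tact A x).
Proof. exact: tmap2_linearr. Qed.

Lemma act_endoD A A' : act_endo (A + A') = act_endo A + act_endo A'.
Proof.
apply: endo_ext => v.
by have := tact_linearl (tpure v) 1 A A'; rewrite !scale1r.
Qed.

Lemma act_endo1 : act_endo 1 = 1.
Proof.
apply: endo_ext => v; rewrite [LHS]tact_pure; congr tpure.
by apply: eq_from_tnth => j; rewrite !tnth_mktuple /restr_act scale1r.
Qed.

Lemma act_endoM A A' : act_endo (A * A') = act_endo A * act_endo A'.
Proof.
apply: endo_ext => v.
rewrite endo_mulE !act_endoE.
move: A; apply: tpow_linear_eq => [||a].
- exact: linear_comp (tact_linearl _) (tmul_linearl _).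
- exact: tact_linearl.
move: A'; apply: tpow_linear_eq => [||a'].
- exact: linear_comp (tact_linearl _) (tmul_linearr _).
- exact: linear_comp (tact_linearr _) (tact_linearl _).
rewrite tpure_mul !tact_pure; congr tpure; apply: eq_from_tnth => j.
by rewrite !tnth_mktuple /restr_act scalerA.
Qed.

(** Both sides put the factors of [A] on the slots [s] of the permuted tensor;
    on the right they are applied before the permutation, hence in the slots
    [sg s]. *)
Lemma act_legs_perm m (s : m.-tuple 'I_n) (us : uniq s) (sg : 'S_n)
    (usg : uniq (map_tuple sg s)) A :
  act_endo (legs us A) * P sg = P sg * act_endo (legs usg A).
Proof.
apply: endo_ext => v; rewrite !endo_mulE !act_endoE.
move: A; apply: tpow_linear_eq => [||u].
- exact: linear_comp (tact_linearl _) (legs_linear _).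
- apply: linear_comp (endo_linear _) _.
  exact: linear_comp (tact_linearl _) (legs_linear _).
rewrite !legs_pure perm_endo_pure !tact_pure perm_endo_pure; congr tpure.
apply: eq_from_tnth => j; rewrite !tnth_mktuple /=.
by rewrite index_map //; exact: perm_inj.
Qed.

Definition leg2 (a b : 'I_n) (ab : uniq [:: a; b]) (A : tpow 2 H) :=
  act_endo (@legs k H n 2 [tuple a; b] ab A).

Lemma leg2_perm (a b a' b' : 'I_n) ab ab' (sg : 'S_n) A :
  sg a = a' -> sg b = b' ->
  @leg2 a b ab A * P sg = P sg * @leg2 a' b' ab' A.
Proof.
move=> ea eb; have usg : uniq (map_tuple sg [tuple a; b]).
  by rewrite map_inj_uniq //; exact: perm_inj.
rewrite /leg2 (act_legs_perm ab usg); congr (_ * act_endo _).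
by apply: eq_legs; rewrite /= ea eb.
Qed.

Lemma leg2M a b ab A A' :
  @leg2 a b ab (A * A') = leg2 ab A * leg2 ab A'.
Proof. by rewrite /leg2 legsM act_endoM. Qed.

Lemma leg21 a b ab : @leg2 a b ab 1 = 1.
Proof. by rewrite /leg2 legs1 act_endo1. Qed.

Lemma leg2_comm a b c d ab cd A A' : uniq [:: a; b; c; d] ->
  @leg2 a b ab A * @leg2 c d cd A' = leg2 cd A' * leg2 ab A.
Proof.
move=> u; rewrite /leg2 -!act_endoM legs_comm //=.
move: u; rewrite /= !inE !negb_or -!andbA.
move=> /and5P[_ ac ad bc /and3P[bd _ _]].
rewrite ![_ == a]eq_sym ![_ == b]eq_sym.
by rewrite (negPf ac) (negPf ad) (negPf bc) (negPf bd).
Qed.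

End ActEndo.

(** * Reduction of the adjacent relations to the threefold tensor power *)

Section AbstractBraid.
Variables (S : pzRingType) (s t rab rac rbc : S).
Hypotheses (sts : s * t * s = t * s * t)
  (rab_t : rab * t = t * rac) (rac_t : rac * t = t * rab)
  (rbc_s : rbc * s = s * rac) (rac_s : rac * s = s * rbc)
  (ybe : rab * rac * rbc = rbc * rac * rab).

Let push {x y u v : S} z (e : x * y = u * v) : z * x * y = z * u * v.
Proof. by rewrite -mulrA e mulrA. Qed.

Let b0 := s * rab.
Let b1 := t * rbc.

(** Here [s] and [t] stand for the swaps of the slots [a], [b] and of the slots
    [b], [c].  Moving them to the left turns both sides into [s t s = t s t]
    times a side of [ybe]. *)
Lemma braid_of_ybe : b0 * b1 * b0 = b1 * b0 * b1.
Proof.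
rewrite /b0 /b1 !mulrA.
rewrite (push _ rab_t) (push _ rbc_s) (push _ rac_s) (push _ rab_t).
rewrite (push _ rbc_s) (push _ rac_t) sts.
by have := congr1 ( *%R (t * s * t)) ybe; rewrite !mulrA.
Qed.

Variables (xab xac xbc : S).
Hypotheses (xab_t : xab * t = t * xac) (xac_t : xac * t = t * xab)
  (xbc_s : xbc * s = s * xac) (xac_s : xac * s = s * xbc)
  (cube : rbc * xbc * rac * rab + rbc * rac * xac * rab + rbc * rac * rab * xab
     = rab * xab * rac * rbc + rab * rac * xac * rbc + rab * rac * rbc * xbc).

(** Moving the swaps to the left turns the three terms on each side into
    [s t s = t s t] times the corresponding terms of [cube]. *)
Lemma cartier_of_cube :
  b0 * (xab * b1 + b1 * xbc) * b0 + b0 * b1 * b0 * xab =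
  b1 * (xbc * b0 + b0 * xab) * b1 + b1 * b0 * b1 * xbc.
Proof.
rewrite !(mulrDl, mulrDr) /b0 /b1 !mulrA.
rewrite !(push _ rab_t, push _ rbc_s, push _ rac_s, push _ rac_t,
  push _ xab_t, push _ xbc_s, push _ xac_s, push _ xac_t).
rewrite sts.
by have := congr1 ( *%R (t * s * t)) cube; rewrite !mulrDr !mulrA.
Qed.

End AbstractBraid.

(** Both sides are the transposition of [a] and [c]: each is one transposition
    conjugated by the other. *)
Lemma tperm_braid (T : finType) (a b c : T) : uniq [:: a; b; c] ->
  (tperm a b * tperm b c * tperm a b = tperm b c * tperm a b * tperm b c)%g.
Proof.
rewrite /= !inE negb_or andbT => /andP[/andP[ab ac] bc].
have conjE (x y u v : T) :
    (tperm x y * tperm u v * tperm x y = tperm u v ^ tperm x y)%g.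
  by rewrite conjgE tpermV mulgA.
by rewrite !conjE !tpermJ tpermR tpermL !tpermD // eq_sym.
Qed.

(** * The operators of the representation and their relations *)

Section Generators.
Variables (k : fieldType) (H : algType k) (B : bialgebra H)
  (Q : quasitriangular B) (C : pre_cartier Q) (V : lmodType H) (n : nat).
Local Notation P := (@perm_endo k n (restr V)).
Local Notation L ab := (@leg2 k H V n _ _ ab).

Lemma slots_uniq (i : 'I_n.-1) : uniq [:: slot0 i; slot1 i].
Proof. by rewrite /= inE slot01. Qed.

Definition swap (i : 'I_n.-1) : endo (tpow n (restr V)) :=
  P (tperm (slot0 i) (slot1 i)).

(** The R-matrix acts before the swap, which is how the flipped R-matrix on
    swapped arguments becomes the R-matrix itself; see [beta_endo_pure]. *)
Definition beta_endo i := swap i * L (slots_uniq i) (Rmat Q).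
Definition beta_inv_endo i := L (slots_uniq i) (Rinv Q) * swap i.
Definition gamma_endo i := L (slots_uniq i) (chi C).

Lemma swapK i : swap i * swap i = 1.
Proof. by rewrite /swap -perm_endoM tperm2 perm_endo1. Qed.

Lemma beta_endoV i : beta_endo i * beta_inv_endo i = 1.
Proof.
rewrite /beta_endo mulrA -[_ * _ * L _ _]mulrA -leg2M RmatV leg21 mulr1.
exact: swapK.
Qed.

Lemma beta_inv_endoK i : beta_inv_endo i * beta_endo i = 1.
Proof.
rewrite /beta_endo mulrA -[_ * _ * swap i]mulrA swapK mulr1 -leg2M RinvK.
exact: leg21.
Qed.

Lemma far_uniq (i j : 'I_n.-1) : far i j ->
  uniq [:: slot0 i; slot1 i; slot0 j; slot1 j].
Proof.
by rewrite /far /= !inE -!val_eqE /=; lia.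
Qed.

Lemma swap_leg2 i a b (ab : uniq [:: a; b]) A :
  uniq [:: slot0 i; slot1 i; a; b] -> swap i * L ab A = L ab A * swap i.
Proof.
rewrite /= !inE !negb_or -!andbA => /and5P[_ ia ib ja /and3P[jb _ _]].
by rewrite [RHS](@leg2_perm _ _ _ _ a b a b ab ab) //; apply: tpermD.
Qed.

Lemma swap_comm i j : far i j -> swap i * swap j = swap j * swap i.
Proof.
move=> /far_uniq /=; rewrite !inE !negb_or -!andbA.
move=> /and5P[_ ia ib ja /and3P[jb _ _]].
rewrite /swap -!perm_endoM; congr P.
by rewrite [LHS]conjgC tpermJ !tpermD // eq_sym.
Qed.

Lemma far_sym (i j : 'I_n.-1) : far i j -> far j i.
Proof. by rewrite /far orbC. Qed.

Lemma gamma_comm i j : far i j ->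
  gamma_endo i * gamma_endo j = gamma_endo j * gamma_endo i.
Proof. by move=> /far_uniq; exact: leg2_comm. Qed.

Lemma beta_gamma_comm i j : far i j ->
  beta_endo i * gamma_endo j = gamma_endo j * beta_endo i.
Proof.
move=> /far_uniq ij; rewrite /beta_endo -mulrA leg2_comm // !mulrA.
by rewrite swap_leg2.
Qed.

Lemma beta_comm i j : far i j ->
  beta_endo i * beta_endo j = beta_endo j * beta_endo i.
Proof.
move=> ij; have ji := far_sym ij.
rewrite /beta_endo !mulrA -[_ * swap j]mulrA -swap_leg2 ?far_uniq //.
rewrite -[_ * swap i]mulrA -swap_leg2 ?far_uniq //.
by rewrite !mulrA swap_comm // -!mulrA leg2_comm // far_uniq.
Qed.

Section Adjacent.
Variables (i j : 'I_n.-1).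
Hypothesis ij : j = i.+1 :> nat.

Lemma slots_adj : slot0 j = slot1 i.
Proof. exact: val_inj. Qed.

Lemma slots3_uniq : uniq [:: slot0 i; slot1 i; slot1 j].
Proof.
by rewrite /= !inE -!val_eqE /=; lia.
Qed.

Let abc := slots3_uniq.

Lemma leg2_adj A : L (slots_uniq j) A = L (uniq3_23 abc) A.
Proof. by congr act_endo; apply: eq_legs; rewrite /= slots_adj. Qed.

Let c_neq : (slot0 i != slot1 j) * (slot1 i != slot1 j) * (slot0 i != slot1 i).
Proof.
by move: abc; rewrite /= !inE negb_or -!andbA => /and4P[-> -> -> _].
Qed.

Lemma leg12_swapj A :
  L (uniq3_12 abc) A * swap j = swap j * L (uniq3_13 abc) A.
Proof.
rewrite /swap slots_adj; apply: leg2_perm; last exact: tpermL.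
by apply: tpermD; rewrite eq_sym c_neq.
Qed.

Lemma leg13_swapj A :
  L (uniq3_13 abc) A * swap j = swap j * L (uniq3_12 abc) A.
Proof.
rewrite /swap slots_adj; apply: leg2_perm; last exact: tpermR.
by apply: tpermD; rewrite eq_sym c_neq.
Qed.

Lemma leg23_swapi A :
  L (uniq3_23 abc) A * swap i = swap i * L (uniq3_13 abc) A.
Proof.
apply: leg2_perm; first exact: tpermR.
by apply: tpermD; rewrite c_neq.
Qed.

Lemma leg13_swapi A :
  L (uniq3_13 abc) A * swap i = swap i * L (uniq3_23 abc) A.
Proof.
apply: leg2_perm; first exact: tpermL.
by apply: tpermD; rewrite c_neq.
Qed.

Lemma swap_braid : swap i * swap j * swap i = swap j * swap i * swap j.
Proof. by rewrite /swap slots_adj -!perm_endoM tperm_braid. Qed.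

Lemma legs3_12 A : L (uniq3_12 abc) A = act_endo V (legs abc (leg12 A)).
Proof. by rewrite legs_leg12. Qed.

Lemma legs3_13 A : L (uniq3_13 abc) A = act_endo V (legs abc (leg13 A)).
Proof. by rewrite legs_leg13. Qed.

Lemma legs3_23 A : L (uniq3_23 abc) A = act_endo V (legs abc (leg23 A)).
Proof. by rewrite legs_leg23. Qed.

Lemma beta_braid : beta_endo i * beta_endo j * beta_endo i =
  beta_endo j * beta_endo i * beta_endo j.
Proof.
rewrite /beta_endo leg2_adj.
apply: (braid_of_ybe swap_braid (leg12_swapj _) (leg13_swapj _)
  (leg23_swapi _) (leg13_swapi _)).
by rewrite legs3_12 legs3_13 legs3_23 -!act_endoM -!legsM qybe.
Qed.

Lemma beta_gamma_cartier :
  beta_endo i * (gamma_endo i * beta_endo j + beta_endo j * gamma_endo j)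
    * beta_endo i + beta_endo i * beta_endo j * beta_endo i * gamma_endo i =
  beta_endo j * (gamma_endo j * beta_endo i + beta_endo i * gamma_endo i)
    * beta_endo j + beta_endo j * beta_endo i * beta_endo j * gamma_endo j.
Proof.
rewrite /beta_endo /gamma_endo !leg2_adj.
apply: (cartier_of_cube swap_braid (leg12_swapj _) (leg13_swapj _)
  (leg23_swapi _) (leg13_swapi _) (leg12_swapj _) (leg13_swapj _)
  (leg23_swapi _) (leg13_swapi _)).
rewrite !legs3_12 !legs3_13 !legs3_23 -!act_endoM -!legsM -!act_endoD -!legsD.
by rewrite cartier_cube.
Qed.

End Adjacent.

Lemma tact2_pure (x y : H) (u w : restr V) :
  tact (tpure [tuple x; y]) (tpure [tuple u; w]) =
  tpure [tuple restr_act x u; restr_act y w].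
Proof.
rewrite tact_pure; congr tpure.
by apply: eq_from_tnth => -[[|[|j]] hj] //; rewrite tnth_mktuple !(tnth_nth 0).
Qed.

Lemma act_spread2 i (x y : H) (v : n.-tuple (restr V)) :
  [tuple restr_act (tnth (spread [tuple slot0 i; slot1 i] [tuple x; y]) j)
     (tnth v j) | j < n] =
  tset (tset v (slot0 i) (restr_act x (tnth v (slot0 i)))) (slot1 i)
    (restr_act y (tnth v (slot1 i))).
Proof.
apply: eq_from_tnth => l; rewrite !tnth_tset !tnth_mktuple /=.
case: (eqVneq (slot0 i) l) => [<-|l0] /=.
  by rewrite (negPf (slot01 i)).
case: (eqVneq (slot1 i) l) => [<-//|l1] /=.
by rewrite /restr_act scale1r.
Qed.

Lemma gamma_endo_pure i v : gamma_endo i (tpure v) =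
  tinsert i v (tact (chi C) (tpure [tuple tnth v (slot0 i); tnth v (slot1 i)])).
Proof.
rewrite /gamma_endo /leg2 act_endoE.
move: (chi C); apply: tpow2_linear_eq => [||x y].
- exact: linear_comp (tact_linearl _) (legs_linear _).
- exact: linear_comp (blift_linear _) (tact_linearl _).
rewrite legs_pure tact_pure tact2_pure tinsert_pure; congr tpure.
exact: act_spread2.
Qed.

Lemma beta_endo_pure i v : beta_endo i (tpure v) =
  tinsert i v (tact (tflip (Rmat Q))
    (tpure [tuple tnth v (slot1 i); tnth v (slot0 i)])).
Proof.
rewrite /beta_endo endo_mulE /leg2 act_endoE.
move: (Rmat Q); apply: tpow2_linear_eq => [||x y].
- apply: linear_comp (endo_linear _) _.
  exact: linear_comp (tact_linearl _) (legs_linear _).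
- apply: linear_comp (blift_linear _) _.
  exact: linear_comp (tact_linearl _) (blift_linear _).
rewrite legs_pure tact_pure tflip_pure tact2_pure tinsert_pure perm_endo_pure.
rewrite act_spread2; congr tpure; apply: eq_from_tnth => l.
rewrite tnth_mktuple !tnth_tset.
case: tpermP => [->|->|/eqP l0 /eqP l1].
- by rewrite !eqxx (negPf (slot01 i)).
- by rewrite !eqxx (negPf (slot01 i)).
- by rewrite (negPf l0) (negPf l1).
Qed.

Definition cartier_endo (g : cartier_gen n) : endo (tpow n (restr V)) :=
  match g with
  | GBeta i => beta_endo i
  | GBetaInv i => beta_inv_endo i
  | GGamma i => gamma_endo i
  end.

Lemma cartier_endo_rel s t : cartier_rel s t ->
  reval cartier_endo s = reval cartier_endo t.
Proof.
case=> /=.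
- exact: beta_endoV.
- exact: beta_inv_endoK.
- exact: beta_comm.
- exact: gamma_comm.
- exact: beta_gamma_comm.
- exact: beta_braid.
- exact: beta_gamma_cartier.
Qed.

End Generators.

Theorem theorem3p20 (k : fieldType) (char0 : [pchar k] =i pred0)
    (H : algType k) (B : bialgebra H) (Q : quasitriangular B)
    (C : pre_cartier Q) (V : lmodType H) (n : nat) (hn : (2 <= n)%N) :
  exists rho : {rmorphism cartier_ring n -> endo (tpow n (restr V))},
    (forall (i : 'I_n.-1) (v : n.-tuple (restr V)),
       rho (beta i) (tpure v) =
       tinsert i v (tact (tflip (Rmat Q))
         (tpure [tuple tnth v (slot1 i); tnth v (slot0 i)])))
    /\
    (forall (i : 'I_n.-1) (v : n.-tuple (restr V)),
       rho (gamma i) (tpure v) =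
       tinsert i v (tact (chi C)
         (tpure [tuple tnth v (slot0 i); tnth v (slot1 i)]))).
Proof.
exists (pres_lift (@cartier_endo_rel _ _ _ _ C V n)); split=> i v.
  by rewrite -(beta_endo_pure Q); congr (endo_fun _ _); exact: pres_lift_gen.
by rewrite -(gamma_endo_pure C); congr (endo_fun _ _); exact: pres_lift_gen.
Qed.
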